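(* Let $i, j$ be positive integers with $(i,j)\neq(1,1)$, and let $n_1$ and $n_2$ be positive integers with $n_1\geq n_2$. Then the complete bipartite graph $K_{n_1,n_2}$ is $(i,j)$-step competitively orientable if and only if one of the following holds: (a) $i+j=3$, and (i) $n_2\geq 6$ or (ii) $n_1\geq 10$ and $n_2=5$; (b) $i+j\geq 4$ and $n_2\geq 4$; (c) $i\geq 2$, $j\geq 2$, $n_1\geq 6$, and $n_2=3$.
   Context: Graphs are finite, without loops or multiple edges; digraphs are finite, without loops, directed $2$-cycles, or multiple arcs. An orientation of a graph $G$ is a digraph whose underlying graph is $G$ (each edge is replaced by exactly one of its two possible arcs). For a digraph $D$, $d_D(u,v)$ is the number of arcs in a shortest directed path from $u$ to $v$ in $D$. For positive integers $i,j$, two (distinct) vertices $u,v$ of $D$ $(i,j)$-step compete if there is a vertex $w$ (distinct from $u$ and $v$) such that either $1\le d_{D-v}(u,w)\le i$ and $1\le d_{D-u}(v,w)\le j$, or $1\le d_{D-v}(u,w)\le j$ and $1\le d_{D-u}(v,w)\le i$; here $D-x$ is $D$ with the vertex $x$ deleted. $D$ is $(i,j)$-step competitive if any two vertices of $D$ $(i,j)$-step compete. A graph $G$ is $(i,j)$-step competitively orientable if some orientation of $G$ is $(i,j)$-step competitive. *)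

(* Defs.v *)
From mathcomp Require Import all_boot.

Set Implicit Arguments.
Unset Strict Implicit.
Unset Printing Implicit Defensive.

Record sgraph (T : finType) := SGraph {
  edge :> rel T;
  edge_sym : symmetric edge;
  edge_irr : irreflexive edge
}.

Record digraph (T : finType) := Digraph {
  arc :> rel T;
  arc_irr : irreflexive arc;
  arc_no2cycle : forall x y, arc x y -> ~~ arc y x
}.

Definition orientation_of (T : finType) (G : sgraph T) (D : digraph T) : Prop :=
  forall x y, edge G x y = arc D x y || arc D y x.

Definition dipath (T : finType) (D : digraph T) (u : T) (p : seq T) (v : T) :=
  [&& path (arc D) u p, last u p == v & uniq (u :: p)].

(* The path u :: p has size p arcs. Distance is a relation: when v is not
   reachable from u, no d satisfies is_dist D u v d. *)
Definition is_dist (T : finType) (D : digraph T) (u v : T) (d : nat) : Prop :=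
  (exists2 p, dipath D u p v & size p = d) /\
  (forall p, dipath D u p v -> d <= size p).

Section DeleteVertex.
Variables (T : finType) (D : digraph T) (x : T).

Definition del_arc : rel {y : T | y != x} := fun a b => arc D (val a) (val b).

Lemma del_arc_irr : irreflexive del_arc.
Proof. by move=> a; apply: arc_irr. Qed.

Lemma del_arc_no2cycle a b : del_arc a b -> ~~ del_arc b a.
Proof. exact: arc_no2cycle. Qed.

Definition del_vertex : digraph {y : T | y != x} :=
  Digraph del_arc_irr del_arc_no2cycle.

End DeleteVertex.

(* 1 <= d_{D-x}(u,w) <= k, where u and w are required to be vertices of D-x. *)
Definition within_del (T : finType) (D : digraph T) (x u w : T) (k : nat) : Prop :=
  exists (a b : {y : T | y != x}) (d : nat),
    [/\ val a = u, val b = w, is_dist (del_vertex D x) a b d & 1 <= d <= k].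

Definition step_compete (T : finType) (D : digraph T) (i j : nat) (u v : T) : Prop :=
  exists w : T, [/\ w != u, w != v &
    (within_del D v u w i /\ within_del D u v w j) \/
    (within_del D v u w j /\ within_del D u v w i)].

Definition step_competitive (T : finType) (D : digraph T) (i j : nat) : Prop :=
  forall u v : T, u != v -> step_compete D i j u v.

Definition step_competitively_orientable
    (T : finType) (G : sgraph T) (i j : nat) : Prop :=
  exists D : digraph T, orientation_of G D /\ step_competitive D i j.

Section CompleteBipartite.
Variables n1 n2 : nat.

Definition Kbip_edge : rel ('I_n1 + 'I_n2)%type := fun x y =>
  match x, y with
  | inl _, inr _ | inr _, inl _ => true
  | _, _ => false
  end.

Lemma Kbip_edge_sym : symmetric Kbip_edge.
Proof. by case=> [a|a] [b|b]. Qed.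

Lemma Kbip_edge_irr : irreflexive Kbip_edge.
Proof. by case. Qed.

Definition complete_bipartite : sgraph ('I_n1 + 'I_n2)%type :=
  SGraph Kbip_edge_sym Kbip_edge_irr.

End CompleteBipartite.

(* Main.v *)
Require Import Defs.
From mathcomp Require Import all_boot.

(** Call the out-neighbourhood of a vertex [x] of the first part [A_x].

    Sufficiency: a competitive orientation of a small core (4 x 4, 6 x 6, 10 x 5
    or 6 x 3) extends to larger parts by letting each new vertex dominate all
    core vertices of the other part: any vertex starts a walk of length 2 inside
    the core, and a new vertex dominates either its midpoint or its end.

    Necessity: every out-degree is at least 2, whence [n2 >= 3]. If [n2 = 3],
    then [|A_x| >= 2] makes the out-neighbourhoods of the three vertices of the
    second part pairwise disjoint, so [n1 >= 6]; moreover every vertex of the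
    first part then has at most one in-neighbour, which excludes [i = 1] and
    [j = 1]. For [(i, j) = (1, 2)], parity forces two vertices of the same part
    to have a common out-neighbour: the [A_x] pairwise meet and every pair of
    the second part is avoided by some [A_x]. This gives [|A_x| >= 3], so
    [n2 >= 5], and for [n2 = 5] the complements of the 10 pairs all occur among
    the [A_x]. *)

Set Implicit Arguments.
Unset Strict Implicit.
Unset Printing Implicit Defensive.

(** * Walks, distances and vertex deletion *)

Lemma dipath_shortest (T : finType) (D : digraph T) (u v : T) (p : seq T) :
  path D u p -> last u p = v -> exists2 d, d <= size p & is_dist D u v d.
Proof.
move=> Dp <-.
have short : exists n, [exists t : n.-tuple T, dipath D u t (last u p)].
  case/shortenP: Dp => q Dq uq _.
  by exists (size q); apply/existsP; exists (in_tuple q); apply/and3P.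
case: (ex_minnP short) => d /existsP[t Dt] dmin {short}.
have dle q : dipath D u q (last u p) -> d <= size q.
  by move=> Dq; apply: dmin; apply/existsP; exists (in_tuple q).
exists d; last by split=> //; exists t; rewrite // size_tuple.
(* The loop-free path [q] repeats no vertex and uses only vertices of [p], so it is no longer than
   [p]. *)
case/shortenP: Dp dle => q Dq uq sqp dle.
apply: leq_trans (dle q _) _; first by apply/and3P.
by case/andP: uq => _ uq; apply: uniq_leq_size.
Qed.

Section Walks.
Variables (T : finType) (D : digraph T).

Lemma within_del_walk (x u w : T) (p : seq T) (d : nat) :
  u != x -> w != u -> path D u p -> last u p = w -> x \notin p ->
  size p <= d -> within_del D x u w d.
Proof.
move=> ux wu Dp lp xp pd.
have [q qp] : exists q : seq {y : T | y != x}, map val q = p.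
  exists (pmap insub p); rewrite pmap_filter; last exact: insubK.
  apply/all_filterP/allP=> y yp; rewrite isSome_insub.
  by apply: contraNneq xp => <-.
pose a : {y : T | y != x} := exist _ u ux.
rewrite -qp -[u]/(val a) in Dp lp.
rewrite last_map in lp; rewrite path_map in Dp.
have [e eq De] := dipath_shortest (D := del_vertex D x) Dp erefl.
exists a, (last a q), e; split=> //.
rewrite (leq_trans eq) -?(size_map val) ?qp // andbT lt0n.
apply: contra_neq wu => e0; have [[r /and3P[_ /eqP lr _] re] _] := De.
by move: lr re; rewrite -lp e0; case: r => //= <-.
Qed.

Lemma within_del_first (x u w : T) (d : nat) :
  within_del D x u w d -> exists2 z, D u z & z != x.
Proof.
case=> a [b [e [<- _ [[[|c p] /and3P[Dp _ _] pe] _] /andP[e0 _]]]].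
  by rewrite -pe in e0.
by case/andP: Dp => ac _; exists (val c); last exact: (valP c).
Qed.

Lemma within_del_last (x u w : T) (d : nat) :
  within_del D x u w d -> exists2 z, D z w & z != x.
Proof.
case=> a [b [e [_ <- [[p /and3P[Dp lp _] pe] _] /andP[e0 _]]]].
case/lastP: p Dp lp pe => [|p c] Dp lp pe; first by rewrite -pe in e0.
move: Dp lp; rewrite rcons_path last_rcons => /andP[_ Dc] /eqP <-.
by exists (val (last a p)); last exact: (valP (last a p)).
Qed.

Lemma within_del1 (x u w : T) : within_del D x u w 1 -> D u w.
Proof.
case=> a [b [e [<- <- [[[|c [|? ?]] /and3P[Dp lp _] pe] _]]]];
  rewrite -pe //= => _.
by move: Dp lp; rewrite /= andbT => Dac /eqP <-.
Qed.

Lemma within_del2 (x u w : T) : within_del D x u w 2 ->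
  D u w \/ exists2 z, D u z & D z w.
Proof.
case=> a [b [e [<- <- [[[|c [|c' [|? ?]]] /and3P[Dp lp _] pe] _]]]];
  rewrite -pe //= => _.
  by left; move: Dp lp; rewrite /= andbT => Dac /eqP <-.
by right; move: Dp lp => /= /and3P[Dac Dcc' _] /eqP <-; exists (val c).
Qed.

Lemma within_del_leq (x u w : T) (d e : nat) :
  d <= e -> within_del D x u w d -> within_del D x u w e.
Proof.
move=> de [a [b [c [ua bw dc /andP[c0 cd]]]]].
by exists a, b, c; split=> //; rewrite c0 (leq_trans cd).
Qed.

Lemma step_compete_leq (i j i' j' : nat) (u v : T) : i <= i' -> j <= j' ->
  step_compete D i j u v -> step_compete D i' j' u v.
Proof.
move=> ii jj [w [wu wv uvw]]; exists w; split=> //.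
by case: uvw => -[uw vw]; [left | right];
  split; (apply: within_del_leq uw || apply: within_del_leq vw).
Qed.

Lemma step_compete_flip (i j : nat) (u v : T) :
  step_compete D i j u v -> step_compete D j i u v.
Proof. by case=> w [wu wv [|] uvw]; exists w; split=> //; [right | left]. Qed.

Lemma step_compete_sym (i j : nat) (u v : T) :
  step_compete D i j u v -> step_compete D i j v u.
Proof.
by case=> w [wu wv [|] [uw vw]]; exists w; split=> //; [right | left].
Qed.

Lemma step_compete_out (i j : nat) (u v : T) :
  step_compete D i j u v -> exists2 z, D u z & z != v.
Proof. by case=> w [_ _ [[uw _]|[uw _]]]; apply: within_del_first uw. Qed.

(** One competitor reaches [w] by a single arc. The other avoids it, so its last arc into [w] starts
    elsewhere: [w] has two in-neighbours. *)
Lemma step_compete_in (j : nat) (u v : T) : step_compete D 1 j u v ->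
  exists w z, [/\ D u w, D z w & z != u] \/ [/\ D v w, D z w & z != v].
Proof.
case=> w [_ _ [[/within_del1 uw /within_del_last[z zw zu]]
             | [/within_del_last[z zw zv] /within_del1 vw]]]; exists w, z.
  by left.
by right.
Qed.

Lemma step_compete12 (u v : T) : step_compete D 1 2 u v ->
  (exists2 w, D u w & D v w) \/
  exists w z, D z w && (D u w && D v z || D v w && D u z).
Proof.
case=> w [_ _ [[/within_del1 uw /within_del2[vw|[z vz zw]]]
             | [/within_del2[uw|[z uz zw]] /within_del1 vw]]].
- by left; exists w.
- by right; exists w, z; rewrite zw uw vz.
- by left; exists w.
- by right; exists w, z; rewrite zw vw uz orbT.
Qed.

End Walks.

Lemma step_competitively_orientable_leq (T : finType) (G : sgraph T)
    (i j i' j' : nat) : i <= i' -> j <= j' ->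
  step_competitively_orientable G i j -> step_competitively_orientable G i' j'.
Proof.
move=> ii jj [D [GD Dc]]; exists D; split=> // u v uv.
exact: step_compete_leq ii jj (Dc u v uv).
Qed.

Lemma step_competitively_orientable_flip (T : finType) (G : sgraph T)
    (i j : nat) :
  step_competitively_orientable G i j -> step_competitively_orientable G j i.
Proof.
case=> D [GD Dc]; exists D; split=> // u v uv.
exact: step_compete_flip (Dc u v uv).
Qed.

(** * Extending a finite core to larger parts *)

Section Construction.
Variables (rows : seq (seq nat)) (k : nat).

(* Row [x] of [rows] lists the out-neighbours of [inl x] inside the core. Outside
   the core, [inl x] dominates every [inr y], and each [inr y] dominates the
   core rows. *)
Definition beats (x y : nat) :=
  (size rows <= x) || (y < k) && (y \in nth [::] rows x).

Definition step (u v : nat + nat) :=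
  match u, v with
  | inl x, inr y => beats x y
  | inr y, inl x => ~~ beats x y
  | _, _ => false
  end.

Definition core : seq (nat + nat) :=
  map inl (iota 0 (size rows)) ++ map inr (iota 0 k).

(* Walks suffice: they can be shortened to paths, and only the lower bound
   [1 <= d] needs the endpoints to differ. *)
Fixpoint reach (d : nat) (x u w : nat + nat) : bool :=
  if d is e.+1 then
    has (fun z => [&& z != x, step u z & (z == w) || reach e x z w]) core
  else false.

(** The clause [has (step u) core] lets walks be continued inside the core, as [core_out]
    requires. *)
Definition core_competitive (i j : nat) : bool :=
  all (fun u => has (step u) core && all (fun v => (u == v) ||
    has (fun w => [&& w != u, w != v &
      reach i v u w && reach j u v w || reach j v u w && reach i u v w]) core)
    core) core.

Lemma mem_core (u : nat + nat) :
  (u \in core) = match u with inl x => x < size rows | inr y => y < k end.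
Proof.
case: u => z; rewrite mem_cat.
  rewrite mem_map ?mem_iota; last by move=> ? ? [].
  by rewrite [X in _ || X](introF mapP) ?orbF //; case.
rewrite orbC mem_map ?mem_iota; last by move=> ? ? [].
by rewrite [X in _ || X](introF mapP) ?orbF //; case.
Qed.

Variables n1 n2 : nat.
Hypotheses (le_n1 : size rows <= n1) (le_n2 : k <= n2).

Definition code (u : 'I_n1 + 'I_n2) : nat + nat :=
  match u with inl x => inl (val x) | inr y => inr (val y) end.

Lemma code_inj : injective code.
Proof. by case=> u [] v //= [] /val_inj ->. Qed.

Lemma code_onto (u : nat + nat) : u \in core -> exists t, code t = u.
Proof.
rewrite mem_core; case: u => z zlt.
  by exists (inl (Ordinal (leq_trans zlt le_n1))).
by exists (inr (Ordinal (leq_trans zlt le_n2))).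
Qed.

Definition step_arc : rel ('I_n1 + 'I_n2) := fun u v => step (code u) (code v).

Lemma step_arc_irr : irreflexive step_arc.
Proof. by case. Qed.

Lemma step_arc_no2cycle u v : step_arc u v -> ~~ step_arc v u.
Proof. by case: u v => u [] v //=; rewrite /step_arc /= => ->. Qed.

Definition Dstep := Digraph step_arc_irr step_arc_no2cycle.

Lemma orientation_Dstep : orientation_of (complete_bipartite n1 n2) Dstep.
Proof.
by case=> u [] v; rewrite //= /step_arc /=; case: beats.
Qed.

Lemma reach_within_del (d : nat) (x u w : 'I_n1 + 'I_n2) : u != x -> w != u ->
  reach d (code x) (code u) (code w) -> within_del Dstep x u w d.
Proof.
move=> ux wu uw.
(* The condition [w != u] is dropped before the induction because it need not persist along the
   walk. *)
suff [p [Dp lp xp pd]] : exists p,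
    [/\ path Dstep u p, last u p = w, x \notin p & size p <= d].
  exact: within_del_walk Dp lp xp pd.
elim: d u {ux wu} uw => //= d IHd u /hasP[c /code_onto[z <-] /and3P[zx uz]].
have zx' : x != z by apply: contra_neq zx => ->.
case/orP=> [/eqP/code_inj <-|/IHd[p [Dp lp xp pd]]].
  by exists [:: z]; split; rewrite //= ?inE // andbT.
by exists (z :: p); split; rewrite //= ?inE ?negb_or ?zx' // Dp andbT.
Qed.

Section Competitive.
Variables i j : nat.
Hypotheses (k_gt0 : 0 < k) (rows_gt0 : 0 < size rows).
Hypothesis core_c : core_competitive i j.

Lemma core_out (u : 'I_n1 + 'I_n2) :
  exists2 z, code z \in core & Dstep u z.
Proof.
suff [c cc uc] : exists2 c, c \in core & step (code u) c.
  by have [z zc] := code_onto cc; rewrite -zc in cc uc; exists z.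
have [uc|] := boolP (code u \in core).
  by have /andP[/hasP[c]] := allP core_c _ uc; exists c.
rewrite mem_core; case: u => z; rewrite /= -leqNgt => ge_z.
  by exists (inr 0); rewrite ?mem_core //= /beats ge_z.
exists (inl 0); rewrite ?mem_core //= /beats negb_or -ltnNge rows_gt0 /=.
by rewrite ltnNge ge_z.
Qed.

Lemma noncore_arc (u w : 'I_n1 + 'I_n2) : code u \notin core -> code w \in core ->
  Kbip_edge u w -> Dstep u w.
Proof.
rewrite !mem_core; case: u w => u [] w //=; rewrite -leqNgt /step_arc /= /beats.
  by move=> ->.
by rewrite negb_or -ltnNge negb_and -leqNgt => -> ->.
Qed.

(* Follow [v -> z -> w] inside the core: [u] dominates one of [z] and [w]. *)
Lemma noncore_compete (u v : 'I_n1 + 'I_n2) : 0 < i -> 1 < j -> u != v ->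
  code u \notin core -> step_compete Dstep i j u v.
Proof.
move=> i_gt0 j_gt1 uv uc; apply: (@step_compete_leq _ _ 1 2) => //.
have neq_core t : code t \in core -> t != u.
  by move=> tc; apply: contraNneq uc => <-.
have [z zc vz] := core_out v; have [w wc zw] := core_out z.
have vz' : z != v by apply: contraTneq vz => ->; rewrite arc_irr.
have wv : w != v by apply: contraTneq zw => ->; apply: arc_no2cycle.
have [uz|uz] := boolP (Kbip_edge u z).
  exists z; split=> //; [exact: neq_core | left; split].
    apply: (within_del_walk (p := [:: z])) => //=; first exact: neq_core.
      by rewrite andbT; apply: noncore_arc.
    by rewrite inE eq_sym.
  apply: (within_del_walk (p := [:: z])) => //=; first by rewrite eq_sym.
    by rewrite andbT.
  by rewrite inE eq_sym neq_core.
(* Here [u] and [z] are in the same part, so the arc from [z] to [w] puts [w] in the opposite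
   one. *)
have uw : Dstep u w.
  apply: noncore_arc => //.
  by case: u z w uz zw {zc wc vz vz' wv uv uc neq_core} => u [] z [] w.
exists w; split=> //; [exact: neq_core | left; split].
  apply: (within_del_walk (p := [:: w])) => //=; first exact: neq_core.
    by rewrite andbT.
  by rewrite inE eq_sym.
apply: (within_del_walk (p := [:: z; w])) => //=; first by rewrite eq_sym.
  by rewrite andbT; apply/andP.
by rewrite !inE negb_or ![u == _]eq_sym !neq_core.
Qed.

Lemma core_orientable : 0 < i -> 1 < j ->
  step_competitively_orientable (complete_bipartite n1 n2) i j.
Proof.
move=> i_gt0 j_gt1; exists Dstep.
split=> [|u v uv]; first exact: orientation_Dstep.
have [uc|uc] := boolP (code u \in core); last exact: noncore_compete.
have [vc|vc] := boolP (code v \in core); last first.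
  by apply: step_compete_sym; apply: noncore_compete; rewrite // eq_sym.
have /andP[_ /allP/(_ _ vc)] := allP core_c _ uc.
rewrite (inj_eq code_inj) (negPf uv) /= => /hasP[c /code_onto[w <-]].
rewrite !(inj_eq code_inj) => /and3P[wu wv uvw]; exists w; split=> //.
by case/orP: uvw => /andP[uw vw]; [left | right]; split;
  apply: reach_within_del; rewrite // eq_sym.
Qed.

End Competitive.
End Construction.

(** * Explicit cores, checked by computation *)

Definition rows4 := [:: [:: 0; 1]; [:: 1; 2]; [:: 2; 3]; [:: 3; 0]].
(* The translates of {0, 1, 3} in Z/6: the differences of this set, and those of
   its complement, exhaust Z/6. *)
Definition rows6 := [:: [:: 0; 1; 3]; [:: 1; 2; 4]; [:: 2; 3; 5]; [:: 3; 4; 0];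
  [:: 4; 5; 1]; [:: 5; 0; 2]].
(* All 3-subsets of a 5-set: by [necessary_12_n1] no other choice is possible. *)
Definition rows5 := [:: [:: 0; 1; 2]; [:: 0; 1; 3]; [:: 0; 1; 4]; [:: 0; 2; 3];
  [:: 0; 2; 4]; [:: 0; 3; 4]; [:: 1; 2; 3]; [:: 1; 2; 4]; [:: 1; 3; 4];
  [:: 2; 3; 4]].
(** Each pair occurs twice: by [out_r_disjoint], each of the three second-part vertices needs two
    rows missing it alone. *)
Definition rows3 := [:: [:: 0; 1]; [:: 0; 1]; [:: 0; 2]; [:: 0; 2];
  [:: 1; 2]; [:: 1; 2]].

Lemma Kbip4_orientable13 (n1 n2 : nat) : 4 <= n1 -> 4 <= n2 ->
  step_competitively_orientable (complete_bipartite n1 n2) 1 3.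
Proof. by move=> h1 h2; apply: (@core_orientable rows4 4); last vm_compute. Qed.

Lemma Kbip4_orientable22 (n1 n2 : nat) : 4 <= n1 -> 4 <= n2 ->
  step_competitively_orientable (complete_bipartite n1 n2) 2 2.
Proof. by move=> h1 h2; apply: (@core_orientable rows4 4); last vm_compute. Qed.

Lemma Kbip6_orientable12 (n1 n2 : nat) : 6 <= n1 -> 6 <= n2 ->
  step_competitively_orientable (complete_bipartite n1 n2) 1 2.
Proof. by move=> h1 h2; apply: (@core_orientable rows6 6); last vm_compute. Qed.

Lemma Kbip5_orientable12 (n1 n2 : nat) : 10 <= n1 -> 5 <= n2 ->
  step_competitively_orientable (complete_bipartite n1 n2) 1 2.
Proof. by move=> h1 h2; apply: (@core_orientable rows5 5); last vm_compute. Qed.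

Lemma Kbip3_orientable22 (n1 n2 : nat) : 6 <= n1 -> 3 <= n2 ->
  step_competitively_orientable (complete_bipartite n1 n2) 2 2.
Proof. by move=> h1 h2; apply: (@core_orientable rows3 3); last vm_compute. Qed.

(** * Lower bounds on the sizes of the parts *)

Section Necessity.
Variables (n1 n2 : nat) (D : digraph ('I_n1 + 'I_n2)%type).
Hypotheses (n1_gt0 : 0 < n1) (n2_gt0 : 0 < n2).
Hypothesis D_or : orientation_of (complete_bipartite n1 n2) D.

Lemma arc_lr (x : 'I_n1) (y : 'I_n2) :
  D (inl x) (inr y) = ~~ D (inr y) (inl x).
Proof.
have := D_or (inl x) (inr y); have := @arc_no2cycle _ D (inl x) (inr y).
by case: (D _ _) => [->|] //= _ <-.
Qed.

Lemma arc_ll (x x' : 'I_n1) : D (inl x) (inl x') = false.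
Proof. by have := D_or (inl x) (inl x'); case: (D _ _). Qed.

Lemma arc_rr (y y' : 'I_n2) : D (inr y) (inr y') = false.
Proof. by have := D_or (inr y) (inr y'); case: (D _ _). Qed.

Section General.
Variables i j : nat.
Hypothesis D_c : step_competitive D i j.

(** When [x] competes with [y], its walk avoids [y] from the first arc on. Taking [y] to be an
    out-neighbour produces a second one. *)
Lemma out_l (x : 'I_n1) (y : 'I_n2) : exists2 z, D (inl x) (inr z) & z != y.
Proof.
have [[z|z]] := step_compete_out (D_c (isT : inl x != inr y)).
  by rewrite arc_ll.
by exists z.
Qed.

Lemma out_r (y : 'I_n2) (x : 'I_n1) : exists2 z, D (inr y) (inl z) & z != x.
Proof.
have [[z|z]] := step_compete_out (D_c (isT : inr y != inl x)).
  by exists z.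
by rewrite arc_rr.
Qed.

(** Some vertex of the first part has an in-neighbour and two out-neighbours, all distinct. *)
Lemma necessary_n2 : 3 <= n2.
Proof.
pose x0 := Ordinal n1_gt0; pose y0 := Ordinal n2_gt0.
have [x y0x _] := out_r y0 x0.
have [y1 xy1 y10] := out_l x y0; have [y2 xy2 y21] := out_l x y1.
have y20 : y2 != y0.
  by apply: contraTneq xy2 => ->; rewrite arc_lr y0x.
have := max_card [set y0; y1; y2]; rewrite card_ord.
rewrite -setUA !cardsU1 cards1 !inE negb_or.
by rewrite ![y0 == _]eq_sym (eq_sym y1) y10 y20 y21.
Qed.

(** Two in-neighbours of [x] together with two out-neighbours would make four vertices in the second
    part. *)
Lemma out_r_disjoint (y y' : 'I_n2) (x : 'I_n1) : n2 = 3 ->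
  D (inr y) (inl x) -> D (inr y') (inl x) -> y = y'.
Proof.
move=> n23 yx y'x; apply: contra_eq n23 => yy'.
have [y1 xy1 _] := out_l x y; have [y2 xy2 y21] := out_l x y1.
have neq a b : D (inr a) (inl x) -> D (inl x) (inr b) -> a != b.
  by move=> ax; apply: contraTneq => <-; rewrite arc_lr ax.
rewrite gtn_eqF //.
have := max_card [set y; y'; y1; y2]; rewrite card_ord.
by rewrite -!setUA !cardsU1 cards1 !inE !negb_or (eq_sym y1) yy' y21 !neq.
Qed.

Lemma necessary_n1 : n2 = 3 -> 6 <= n1.
Proof.
move=> n23; pose x0 := Ordinal n1_gt0.
(* By [out_r] the [pick] always succeeds, so the default is never returned. Two picks give each [y]
   two out-neighbours, and disjointness makes [f] inject ['I_n2 * bool] into ['I_n1]. *)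
pose g y x := odflt x [pick z | D (inr y) (inl z) && (z != x)].
have gP y x : D (inr y) (inl (g y x)) /\ g y x != x.
  rewrite /g; case: pickP => [z /andP[]|no] //.
  by have [z yz zx] := out_r y x; have := no z; rewrite yz zx.
pose f y b := if b then g y x0 else g y (g y x0).
have f_arc y b : D (inr y) (inl (f y b)).
  by case: b; exact: (gP _ _).1.
have f_neq y : f y false != f y true by exact: (gP _ _).2.
have f_inj : injective (fun p => f p.1 p.2).
  move=> [y b] [y' b'] /= fE; have yy' : y = y'.
    by apply: out_r_disjoint n23 (f_arc y b) _; rewrite fE.
  subst y'; congr (_, _); case: b b' fE => -[] // /eqP; rewrite ?(negPf (f_neq y)) //.
  by rewrite eq_sym (negPf (f_neq y)).
by have := leq_card _ f_inj; rewrite card_prod card_bool !card_ord n23.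
Qed.

End General.

Lemma necessary_1j (j : nat) : step_competitive D 1 j -> 4 <= n2.
Proof.
move=> D_c; rewrite ltn_neqAle (necessary_n2 D_c) andbT eq_sym.
apply/negP => /eqP n23.
have n2_gt1 : 1 < n2 by rewrite n23.
pose y0 := Ordinal n2_gt0; pose y1 := Ordinal n2_gt1.
have yy' : inr y0 != inr y1 :> 'I_n1 + 'I_n2 by [].
have unique_in y w z : D (inr y) w -> D z w -> z = inr y.
  case: w z => w [] z; rewrite ?arc_ll ?arc_rr // => yw zw; congr inr.
  exact: (out_r_disjoint D_c n23) zw yw.
have [w [z [] [yw zw]]] := step_compete_in (D_c _ _ yy');
  by rewrite (unique_in _ _ _ yw zw) eqxx.
Qed.

(** * The case of (1,2)-step competition *)

Section OneTwo.
Hypothesis D_c : step_competitive D 1 2.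

Lemma meet_l (x x' : 'I_n1) : x != x' ->
  exists2 y, D (inl x) (inr y) & D (inl x') (inr y).
Proof.
move=> xx'; have neq : inl x != inl x' :> 'I_n1 + 'I_n2 by [].
(* Walks of lengths 1 and 2 from the same part end in different parts, so only the common
   out-neighbour survives. *)
have [[[w|w]]|[[w|w] [[z|z]]]] := step_compete12 (D_c neq);
  rewrite ?arc_ll ?arc_rr ?andbF //.
by exists w.
Qed.

Lemma meet_r (y y' : 'I_n2) : y != y' ->
  exists2 x, D (inr y) (inl x) & D (inr y') (inl x).
Proof.
move=> yy'; have neq : inr y != inr y' :> 'I_n1 + 'I_n2 by [].
have [[[w|w]]|[[w|w] [[z|z]]]] := step_compete12 (D_c neq);
  rewrite ?arc_ll ?arc_rr ?andbF //.
by exists w.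
Qed.

Definition out_set (x : 'I_n1) : {set 'I_n2} := [set y | D (inl x) (inr y)].

(* Two out-neighbours of [x] are both avoided by some [x'], which still has to
   share an out-neighbour with [x]. *)
Lemma out_set_ge3 (x : 'I_n1) : 2 < #|out_set x|.
Proof.
have [y1 xy1 _] := out_l D_c x (Ordinal n2_gt0).
have [y2 xy2 y21] := out_l D_c x y1.
have [x' y2x' y1x'] := meet_r y21.
have xx' : x != x' by apply: contraTneq xy1 => ->; rewrite arc_lr y1x'.
have [z xz x'z] := meet_l xx'.
have neq y : D (inr y) (inl x') -> y != z.
  by move=> yx'; apply: contraTneq x'z => <-; rewrite arc_lr yx'.
have : [set y2; y1; z] \subset out_set x.
  by apply/subsetP => y; rewrite !inE => /orP[/orP[]|] /eqP ->.
move/subset_leq_card; apply: leq_trans.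
by rewrite -setUA !cardsU1 cards1 !inE negb_or y21 !neq.
Qed.

Lemma out_set_avoids (y y' : 'I_n2) : y != y' ->
  exists x, out_set x \subset ~: [set y; y'].
Proof.
move=> /meet_r[x yx y'x]; exists x; apply/subsetP => z; rewrite !inE.
by apply: contraTN => /orP[] /eqP ->; rewrite arc_lr ?yx ?y'x.
Qed.

Lemma necessary_12_n2 : 5 <= n2.
Proof.
have n2_gt1 : 1 < n2 by apply: ltnW; apply: necessary_n2 D_c.
have [//|x] := @out_set_avoids (Ordinal n2_gt0) (Ordinal n2_gt1).
move/subset_leq_card/(leq_trans (out_set_ge3 x)).
by rewrite cardsCs setCK cards2 card_ord ltn_subRL.
Qed.

Lemma necessary_12_n1 : n2 = 5 -> 10 <= n1.
Proof.
move=> n25.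
have -> : 10 = #|[set S : {set 'I_n2} | #|S| == 2]|.
  by rewrite card_draws card_ord n25.
have sub S : S \in [set S : {set 'I_n2} | #|S| == 2] ->
    ~: S \in out_set @: [set: 'I_n1].
  rewrite inE => /cards2P[y [y' [yy' ->]]].
  have [x xS] := out_set_avoids yy'; apply/imsetP; exists x => //.
  (* The complement of the pair has 5 - 2 = 3 elements and the out-set inside it at least 3, so they
     coincide. *)
  apply/esym/eqP; rewrite eqEcard xS cardsCs setCK cards2 card_ord yy'.
  exact: leq_trans (leq_sub2r 2 (eq_leq n25)) (out_set_ge3 x).
rewrite -(card_imset _ (@setC_inj _)) -[n1]card_ord -cardsT.
apply: leq_trans (leq_imset_card out_set _).
by apply: subset_leq_card; apply/subsetP => _ /imsetP[S /sub ? ->].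
Qed.

End OneTwo.
End Necessity.

(** * Assembling the characterization *)

Theorem theorem1 (i j : nat) (hi : 0 < i) (hj : 0 < j) (hij : (i, j) <> (1, 1))
    (n1 n2 : nat) (hn1 : 0 < n1) (hn2 : 0 < n2) (hn : n2 <= n1) :
  step_competitively_orientable (complete_bipartite n1 n2) i j <->
  [\/ i + j = 3 /\ (6 <= n2 \/ (10 <= n1 /\ n2 = 5)),
      4 <= i + j /\ 4 <= n2
    | [/\ 2 <= i, 2 <= j, 6 <= n1 & n2 = 3]].
Proof.
(* Competition and the three conditions are symmetric in [i] and [j]. *)
wlog ij : i j hi hj hij / i <= j.
  move=> wlog_ij; have [|/ltnW ji] := leqP i j; first exact: wlog_ij.
  have ji1 : (j, i) <> (1, 1) by case=> j1 i1; apply: hij; rewrite i1 j1.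
  split=> [/step_competitively_orientable_flip|h].
    by case/(wlog_ij j i hj hi ji1 ji); rewrite addnC => h;
      [constructor 1 | constructor 2 | constructor 3; case: h].
  apply/step_competitively_orientable_flip/(wlog_ij j i hj hi ji1 ji).
  by case: h; rewrite addnC => h;
    [constructor 1 | constructor 2 | constructor 3; case: h].
have j_gt1 : 1 < j.
  by rewrite ltnNge; apply/negP => j1; apply: hij; congr (_, _); apply/eqP;
    rewrite eqn_leq ?hi ?hj ?(leq_trans ij j1) ?j1.
split=> [[D [D_or D_c]] | ].
  have [i_gt1|i_le1] := ltnP 1 i.
    have := necessary_n2 hn1 hn2 D_or D_c.
    rewrite leq_eqVlt => /predU1P[n23|n2_gt3].
      by constructor 3; split=> //; apply: (necessary_n1 hn1 D_or D_c).
    by constructor 2; rewrite (leq_add i_gt1 j_gt1).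
  have i1 : i = 1 by apply/eqP; rewrite eqn_leq i_le1.
  subst i; move: j_gt1; rewrite leq_eqVlt => /predU1P[j2|j_gt2]; last first.
    by constructor 2; split=> //; apply: necessary_1j D_c.
  subst j; constructor 1; split=> //.
  have := necessary_12_n2 hn1 hn2 D_or D_c.
  rewrite leq_eqVlt => /predU1P[n25|]; last by left.
  by right; split=> //; apply: (necessary_12_n1 hn2 D_or D_c).
(* By monotonicity it suffices to treat the minimal pairs (1,2), (1,3) and (2,2). *)
have lift i0 j0 := @step_competitively_orientable_leq _
  (complete_bipartite n1 n2) i0 j0 i j.
case=> [[_ [n2_ge6|[n1_ge10 n25]]]|[ij4 n2_ge4]|[i_gt1 _ n1_ge6 n23]].
- by apply: (lift 1 2) => //; apply: Kbip6_orientable12; rewrite ?(leq_trans n2_ge6).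
- by apply: (lift 1 2) => //; apply: Kbip5_orientable12; rewrite ?n25.
- have n1_ge4 := leq_trans n2_ge4 hn.
  have [i_gt1|i_le1] := ltnP 1 i.
    by apply: (lift 2 2) => //; apply: Kbip4_orientable22.
  apply: (lift 1 3) => //; last exact: Kbip4_orientable13.
  by rewrite -(leq_add2l 1); apply: leq_trans ij4 _; rewrite leq_add2r.
- by apply: (lift 2 2) => //; apply: Kbip3_orientable22; rewrite ?n23.
Qed.
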